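(* Let $k>0$. In the RC-CPPG, for any real pair $(L,T)$ with $L>0$, $T>1$ satisfying $$(T-1)\,f\Big(\frac{L}{T-1}\Big)= N-2k^2,$$ there exists a feasible up-and-down path (a type-$d$ up-and-down path for some $d\in(0,2k]$) of length $L'$ with $T'$ stops such that $$L'-L\le 3m+2k\qquad\text{and}\qquad \frac{T'}{T}\le\Big(1+\frac{2k^2}{N-2k^2}\Big)\Big(1+\frac{4k}{n}\Big)^2 .$$
   Context: Let $m\ge n\ge 1$ be integers, $N=mn$, $D=\{(x,y)\in\mathbb{R}^2: 0\le x\le n,\ 0\le y\le m\}$. Distances are $\ell_1$ distances. The function $f$ is $f(d)=d(2k-\frac d2)$ for $d\in(0,2k]$ and $f(d)=2k^2$ for $d>2k$. RC-CPPG with coverage radius $k$: a covering path visits finitely many stops in $D$ such that every point of $D$ is within $\ell_1$ distance $k$ of some stop; its two costs are its path length and its stop count. A path is feasible if it is a covering path. Type-$d$ up-and-down path ($0<d\le 2k$): put $r=2k-\frac d2$. The path has vertical traversals, i.e. the segments from $(s,0)$ to $(s,m)$, at $s=0,r,2r,\dots,\lfloor n/r\rfloor r$, and, if $n/r$ is not an integer, a last traversal at $s=n$. It goes up the first traversal, moves horizontally along the top side to the second, goes down the second, moves horizontally along the bottom side to the third, and so on: $(0,0)\to(0,m)\to(r,m)\to(r,0)\to(2r,0)\to(2r,m)\to\cdots$. On the 1st, 3rd, 5th, ... traversals there are stops at heights $jd$ ($j=0,1,2,\dots$, $jd\le m$); on the 2nd, 4th, ... traversals there are stops at heights $jd+\frac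 d2$ ($j=0,1,\dots$, $jd+\frac d2\le m$); in addition every traversal has a stop at height $m$. Its path length is the length of this polygonal path. *)

(* Defs.v *)
From HB Require Import structures.
From mathcomp Require Import all_boot all_order all_algebra.
From mathcomp Require Import reals.

Set Implicit Arguments.
Unset Strict Implicit.
Unset Printing Implicit Defensive.

Import Order.TTheory GRing.Theory Num.Theory.
Local Open Scope ring_scope.

Section CoveringPaths.
Variable R : realType.
Implicit Types (p q u v : R * R) (vs : seq (R * R)) (k d : R) (m n : nat).

Definition dist1 p q : R := `|p.1 - q.1| + `|p.2 - q.2|.

(* The rectangle D has width n and height m. *)
Definition in_region m n p : bool :=
  (0 <= p.1 <= n%:R) && (0 <= p.2 <= m%:R).

(* A polygonal path, given by its successive vertices, together with the list
   of stops made along it; the order in which the stops are listed is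
   irrelevant. *)
Record stop_path := StopPath {
  vertices : seq (R * R);
  stops : seq (R * R)
}.

Definition edges vs : seq ((R * R) * (R * R)) := zip vs (behead vs).

Definition on_segment u v p : Prop :=
  exists2 t : R, 0 <= t <= 1 &
    p = ((1 - t) * u.1 + t * v.1, (1 - t) * u.2 + t * v.2).

(* The first disjunct only matters for a path reduced to a single vertex,
   which has no edge. *)
Definition visits vs p : Prop :=
  p \in vs \/ exists2 e, e \in edges vs & on_segment e.1 e.2 p.

Definition path_length (P : stop_path) : R :=
  \sum_(e <- edges (vertices P)) dist1 e.1 e.2.

Definition stop_count (P : stop_path) : nat := size (stops P).

Definition feasible k m n (P : stop_path) : Prop :=
  (forall q, q \in stops P -> visits (vertices P) q /\ in_region m n q) /\
  (forall p, in_region m n p -> exists2 q, q \in stops P & dist1 p q <= k).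

(* Only the values at d > 0 are meaningful. *)
Definition f k d : R :=
  if d <= 2 * k then d * (2 * k - d / 2) else 2 * k ^+ 2.

Definition spacing k d : R := 2 * k - d / 2.

Definition traversals k n d : seq R :=
  let r := spacing k d in
  [seq i%:R * r | i <- iota 0 (Num.truncn (n%:R / r)).+1]
    ++ (if n%:R / r \is a Num.int then [::] else [:: n%:R]).

(* Traversals are numbered from 0, so the 1st, 3rd, 5th, ... ones are those of
   even index i. *)
Definition traversal_vertices m (i : nat) (s : R) : seq (R * R) :=
  if odd i then [:: (s, m%:R); (s, 0)] else [:: (s, 0); (s, m%:R)].

(* Every j with j * d <= m is at most the integer part of m / d, hence the
   range of j.  The top height m may also be one of the regular heights, and
   is then a single stop. *)
Definition stop_heights m d (i : nat) : seq R :=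
  let h j := j%:R * d + (if odd i then d / 2 else 0) in
  undup ([seq y <- [seq h j | j <- iota 0 (Num.truncn (m%:R / d)).+1]
            | y <= m%:R] ++ [:: m%:R]).

Definition updown_path k m n d : stop_path :=
  let ss := traversals k n d in
  let indexed := zip (iota 0 (size ss)) ss in
  StopPath
    (flatten [seq traversal_vertices m e.1 e.2 | e <- indexed])
    (flatten [seq [seq (e.2, y) | y <- stop_heights m d e.1] | e <- indexed]).

End CoveringPaths.

(* Main.v *)
(* Take d = min (L / (T - 1), 2k) and r = 2k - d/2, so that f gives
   (T - 1) d r = N - 2k^2 and d (T - 1) <= L.  There are at most n/r + 2
   traversals, with at most m/d + 2 stops each.  Hence the length is at most
   (n/r + 2) m + n <= N/r + 3m, while L >= (N - 2k^2) / r >= N/r - 2k as r >= k;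
   and the stop count is at most N/(dr) (1 + 2r/n) (1 + 2d/m), while
   T >= (N - 2k^2) / (dr).
   For the covering property, a point between two adjacent traversals lies
   between a stop of one and a stop of the other that are at most r apart
   horizontally and d/2 vertically; its distances to these two stops sum to at
   most r + d/2 = 2k. *)
Require Import Defs.
From mathcomp Require Import all_boot all_order all_algebra.
From mathcomp Require Import reals ring lra.

Set Implicit Arguments.
Unset Strict Implicit.
Unset Printing Implicit Defensive.

Import Order.TTheory GRing.Theory Num.Theory.
Local Open Scope ring_scope.

(** * The polygonal path: its edges and the points it visits *)

Definition numbered {T : Type} (i : nat) (ss : seq T) : seq (nat * T) :=
  zip (iota i (size ss)) ss.

(** The index of the first traversal is a parameter: an induction that drops one traversal flips the
    parity of the others. *)
Definition updown_vertices {R : realType} (m i : nat) (ss : seq R) :=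
  flatten [seq traversal_vertices m e.1 e.2 | e <- numbered i ss].

Lemma numbered_cons {T : Type} (i : nat) (s : T) ss :
  numbered i (s :: ss) = (i, s) :: numbered i.+1 ss.
Proof. by []. Qed.

Lemma mem_numbered {T : eqType} (i : nat) (ss : seq T) e :
  e \in numbered i ss -> e.2 \in ss.
Proof.
elim: ss i => [//|s ss IH] i; rewrite numbered_cons !inE => /orP[/eqP ->|/IH ->].
  by rewrite eqxx.
by rewrite orbT.
Qed.

Lemma sub_edges_behead {R : realType} (u : R * R) vs :
  {subset edges vs <= edges (u :: vs)}.
Proof. by case: vs => [//|v vs] e he; rewrite /edges /= inE he orbT. Qed.

Lemma edges_cons2 {R : realType} (u v : R * R) vs :
  edges [:: u, v & vs] = (u, v) :: edges (v :: vs).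
Proof. by []. Qed.

Lemma updown_vertices_cons {R : realType} (m i : nat) (s : R) ss :
  updown_vertices m i (s :: ss) =
  traversal_vertices m i s ++ updown_vertices m i.+1 ss.
Proof. by []. Qed.

Lemma traversal_edges {R : realType} (m i : nat) (ss : seq R) e :
  e \in numbered i ss ->
  {subset edges (traversal_vertices m e.1 e.2)
     <= edges (updown_vertices m i ss)}.
Proof.
elim: ss i => [//|s ss IH] i.
rewrite numbered_cons inE updown_vertices_cons => /orP[/eqP ->|he] x hx.
  by move: hx; rewrite /traversal_vertices /=; case: (odd i);
    rewrite /edges /= !inE => ->.
have := IH _ he x hx; rewrite /traversal_vertices.
(* Each traversal contributes two vertices, so two are skipped to reach the later ones. *)
by case: (odd i) => hx'; do 2! apply: sub_edges_behead.
Qed.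

Lemma visits_traversal {R : realType} (m i : nat) (ss : seq R) e (y : R) :
  (0 < m)%N -> e \in numbered i ss -> 0 <= y <= m%:R ->
  visits (updown_vertices m i ss) (e.2, y).
Proof.
move=> m0 he /andP[y0 ym]; have m0' : 0 < m%:R :> R by rewrite ltr0n.
right; have := traversal_edges (m := m) he; rewrite /traversal_vertices.
have ym1 : y / m%:R <= 1 by rewrite ler_pdivrMr // mul1r.
have ym0 : 0 <= y / m%:R by rewrite divr_ge0 // ltW.
have eym : y = y / m%:R * m%:R by rewrite divfK // gt_eqF.
case: (odd e.1) => hs; eexists; try (by apply: hs; rewrite /edges /= inE).
(* Odd traversals run downwards, hence the reversed parameter. *)
- exists (1 - y / m%:R) => /=; first lra.
  by congr pair; [ring | rewrite {1}eym; ring].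
- exists (y / m%:R) => /=; first lra.
  by congr pair; [ring | rewrite {1}eym; ring].
Qed.

(** * Abscissae with gaps at most [r]: length and location *)

Definition step {R : realType} (r : R) : rel R := fun a b => a <= b <= a + r.

Lemma path_step_mem {R : realType} (r a : R) ss s :
  path (step r) a ss -> s \in a :: ss -> a <= s <= last a ss.
Proof.
elim: ss a s => [a s _|b ss IH a s /= /andP[/andP[ab _] hp]].
  by rewrite inE => /eqP ->; rewrite /= lexx.
have /andP[_ bl] := IH _ _ hp (mem_head _ _).
rewrite inE => /orP[/eqP -> | /(IH _ _ hp)]; last lra.
by rewrite lexx (le_trans ab bl).
Qed.

(** Each traversal has length [m]. Alternating directions make every connection horizontal, and
    since the abscissae increase weakly, the connections telescope. *)
Lemma updown_length {R : realType} (m i : nat) (r a : R) ss :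
  path (step r) a ss ->
  \sum_(e <- edges (updown_vertices m i (a :: ss))) dist1 e.1 e.2 =
  (size ss).+1%:R * m%:R + (last a ss - a).
Proof.
have hv (s : R) : dist1 (s, 0) (s, m%:R) = m%:R.
  by rewrite /dist1 /= subrr normr0 add0r sub0r normrN normr_nat.
have hv' (s : R) : dist1 (s, m%:R) (s, 0) = m%:R.
  by rewrite /dist1 /= subrr normr0 add0r subr0 normr_nat.
have hh (s s' y : R) : s <= s' -> dist1 (s, y) (s', y) = s' - s.
  by move=> h; rewrite /dist1 /= subrr normr0 addr0 distrC ger0_norm // subr_ge0.
elim: ss i a => [|b ss IH] i a.
  move=> _; rewrite /updown_vertices /= /traversal_vertices cats0.
  by case: (odd i); rewrite /edges /= big_seq1 /= ?hv ?hv' subrr; ring.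
move=> /= /andP[/andP[ab _] /(IH i.+1)].
rewrite !updown_vertices_cons /traversal_vertices /=.
by case: (odd i) => /= E;
  rewrite edges_cons2 big_cons edges_cons2 big_cons E /= ?hv ?hv' hh //;
  rewrite [in RHS]mulrSr; ring.
Qed.

(** The two traversals around [x] carry consecutive indices, hence opposite parities, as the
    staggered stops require. *)
Lemma path_step_locate {R : realType} (r a x : R) i ss :
  path (step r) a ss -> ss != [::] -> a <= x <= last a ss ->
  exists j s s', [/\ (j, s) \in numbered i (a :: ss),
    (j.+1, s') \in numbered i (a :: ss), s <= x <= s' & s' <= s + r].
Proof.
elim: ss i a => [//|b ss IH] i a /= /andP[/andP[ab br] hp] _ /andP[ax xl].
have [xb|bx] := leP x b.
  exists i, a, b; rewrite ax xb br !numbered_cons !inE !eqxx /=.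
  by rewrite orbT.
have ss0 : ss != [::].
  by apply: contraTneq xl => ->; rewrite /= -ltNge.
have [|j [s [s' [h1 h2 h3 h4]]]] := IH i.+1 _ hp ss0.
  by rewrite (ltW bx).
by exists j, s, s'; split=> //; rewrite numbered_cons inE ?h1 ?h2 orbT.
Qed.

Lemma path_multiples {R : realType} (r : R) i l : 0 <= r ->
  path (step r) (i%:R * r) [seq j%:R * r | j <- iota i.+1 l].
Proof.
move=> r0; elim: l i => [//|l IH] i /=; rewrite IH andbT /step -natr1.
by rewrite mulrDl mul1r lexx andbT lerDl.
Qed.

Lemma last_multiples {R : realType} (r : R) i l :
  last (i%:R * r) [seq j%:R * r | j <- iota i.+1 l] = (i + l)%:R * r.
Proof. by elim: l i => [|l IH] i /=; rewrite ?addn0 // IH addSnnS. Qed.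

(** With [t] the integer part of [n / r], [t * r <= n < (t + 1) * r]: an appended [n] is within [r]
    of the last multiple, and otherwise [t * r] is [n] itself. The first traversal is not counted in
    [ss]. *)
Lemma traversals_spec {R : realType} (k : R) (n : nat) (d : R) :
  (0 < n)%N -> 0 < spacing k d ->
  exists ss, [/\ traversals k n d = 0 :: ss, path (step (spacing k d)) 0 ss,
    ss != [::], last 0 ss = n%:R &
    (size ss)%:R <= n%:R / spacing k d + 1].
Proof.
move=> n0; rewrite /traversals; set r := spacing k d => r0.
have n0' : 0 < n%:R :> R by rewrite ltr0n.
have q0 : 0 < n%:R / r by rewrite divr_gt0.
have /andP[tq qt] := truncn_itv (ltW q0).
set t := Num.truncn _ in tq qt *.
rewrite ler_pdivlMr // in tq; rewrite ltr_pdivrMr // in qt.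
have := path_multiples 0 t (ltW r0).
have := last_multiples r 0 t; rewrite mul0r add0n => hl hp.
rewrite [iota 0 _]/= map_cons mul0r cat_cons.
eexists; split; first reflexivity.
- rewrite cat_path hp hl; case: ifP => //= _.
  by rewrite /step tq /=; move: qt; rewrite -natr1 mulrDl mul1r andbT => /ltW.
(* If [n / r] is an integer, it is positive, so [t] is at least 1; otherwise [n] was appended. *)
- case: ifP => [hq|_]; last by case: [seq _ | _ <- _].
  have : 0 < t%:R :> R by rewrite truncnK // -intrEge0 // ltW.
  by rewrite ltr0n; case: (t).
- rewrite last_cat hl; case: ifP => [hq|//] /=.
  by rewrite truncnK -?intrEge0 ?divfK ?gt_eqF // ltW.
- rewrite size_cat size_map size_iota natrD.
  by apply: lerD; [rewrite ler_pdivlMr | case: ifP; rewrite ?ler01].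
Qed.

(** * Stop heights on a traversal and on two adjacent ones *)

Lemma top_stop {R : realType} m (d : R) i : m%:R \in stop_heights m d i.
Proof. by rewrite mem_undup mem_cat mem_seq1 eqxx orbT. Qed.

Lemma stop_heights_itv {R : realType} m (d : R) i y :
  0 <= d -> y \in stop_heights m d i -> 0 <= y <= m%:R.
Proof.
move=> d0; rewrite mem_undup mem_cat mem_filter mem_seq1.
case/orP => [/andP[-> /mapP[j _ ->]]|/eqP ->]; last by rewrite ler0n lexx.
rewrite andbT addr_ge0 ?mulr_ge0 //; case: ifP => // _; exact: divr_ge0.
Qed.

Lemma size_stop_heights {R : realType} m (d : R) i : 0 < d ->
  (size (stop_heights m d i))%:R <= m%:R / d + 2.
Proof.
move=> d0; have /truncn_itv/andP[h _] : 0 <= m%:R / d by rewrite divr_ge0 // ltW.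
apply: le_trans (_ : (Num.truncn (m%:R / d)).+2%:R <= _).
  rewrite ler_nat (leq_trans (size_undup _)) // size_cat addn1 ltnS.
  by rewrite size_filter (leq_trans (count_size _ _)) // size_map size_iota.
by rewrite -addn2 natrD lerD2r.
Qed.

(** Writing [l] as twice its half plus its parity turns multiples of [d / 2] into the regular
    heights of traversals of that parity. *)
Lemma half_step_stop {R : realType} m (d : R) i l :
  0 < d -> odd l = odd i -> l%:R * (d / 2) <= m%:R ->
  l%:R * (d / 2) \in stop_heights m d i.
Proof.
move=> d0 li hl; rewrite mem_undup mem_cat mem_filter hl andTb; apply/orP; left.
have el : l%:R * (d / 2) = l./2%:R * d + (if odd i then d / 2 else 0).
  rewrite -[in LHS](odd_double_half l) -li natrD -muln2 natrM.
  by case: (odd l) => /=; field.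
apply/mapP; exists l./2 => //; rewrite mem_iota add0n ltnS /=.
rewrite truncn_ge_nat ?divr_ge0 ?(ltW d0) // ler_pdivlMr //.
by apply: le_trans hl; rewrite el lerDl; case: ifP => // _; lra.
Qed.

(* The stop heights of two adjacent traversals together form a grid of mesh
   d / 2 (up to the top stop), alternating between the two traversals. *)
Lemma alternating_stops {R : realType} m (d : R) i y :
  0 < d -> 0 <= y <= m%:R ->
  exists y1 y2, [/\ y1 \in stop_heights m d i, y2 \in stop_heights m d i.+1 &
    `|y - y1| + `|y - y2| <= d / 2].
Proof.
move=> d0 /andP[y0 ym]; have d20 : 0 < d / 2 by lra.
have /truncn_itv/andP[] : 0 <= y / (d / 2) by rewrite divr_ge0 // ltW.
set l := Num.truncn _; rewrite ler_pdivlMr // ltr_pdivrMr // => hl hl'.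
(* [z] is the next grid height above [y], or [m] if that height exceeds [m]; the top is a stop for
   either parity. *)
have [z [zS zy zl]] : exists z, [/\ forall j, odd l.+1 = odd j ->
    z \in stop_heights m d j, y <= z & z <= l%:R * (d / 2) + d / 2].
  move: hl'; have -> : l.+1%:R * (d / 2) = l%:R * (d / 2) + d / 2.
    by rewrite -[l.+1%:R]natr1 mulrDl mul1r.
  have [h|h] := leP (l%:R * (d / 2) + d / 2) m%:R => hl'.
    exists (l%:R * (d / 2) + d / 2); split => [j lj||]; last 2 first.
    - exact: ltW.
    - exact: lexx.
    have e : l%:R * (d / 2) + d / 2 = l.+1%:R * (d / 2).
      by rewrite -[l.+1%:R]natr1 mulrDl mul1r.
    by rewrite e half_step_stop // -e.
  by exists m%:R; split => [j _||] //; [exact: top_stop | exact: ltW].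
have wS j : odd l = odd j -> l%:R * (d / 2) \in stop_heights m d j.
  by move=> lj; apply: half_step_stop => //; apply: le_trans hl ym.
have hz : `|y - z| = z - y by rewrite distrC ger0_norm // subr_ge0.
have hw : `|y - l%:R * (d / 2)| = y - l%:R * (d / 2).
  by rewrite ger0_norm // subr_ge0.
(* The parity of [l] decides which traversal holds the lower height; the other one holds [z]. *)
have [li|li] := eqVneq (odd l) (odd i).
  exists (l%:R * (d / 2)), z; split; [exact: wS | apply: zS | lra].
  by rewrite /= li.
exists z, (l%:R * (d / 2)); split; [apply: zS | apply: wS | lra];
  by move: li => /=; case: (odd l) (odd i) => [] [].
Qed.

Lemma mem_stops {R : realType} (k : R) m n d i s y :
  (i, s) \in numbered 0 (traversals k n d) -> y \in stop_heights m d i ->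
  (s, y) \in stops (updown_path k m n d).
Proof. by move=> hs hy; apply/allpairsPdep; exists (i, s), y. Qed.

(** * Feasibility, the two costs, and the final estimates *)

Lemma updown_feasible {R : realType} (k : R) (m n : nat) (d : R) :
  (0 < m)%N -> (0 < n)%N -> 0 < d -> 0 < spacing k d ->
  feasible k m n (updown_path k m n d).
Proof.
move=> m0 n0 d0 r0; have [ss [ess hp ss0 hl _]] := traversals_spec n0 r0.
split=> [q|[x y] /andP[hx hy]].
  move=> /allpairsPdep[e [y [he hy ->]]].
  have yI := stop_heights_itv (ltW d0) hy.
  split; first exact: (visits_traversal (i := 0)
    (ss := traversals k n d) m0 he yI).
  rewrite /in_region yI andbT -hl; apply: path_step_mem hp _.
  by rewrite -ess; apply: mem_numbered he.
rewrite -hl in hx.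
have [i [s [s' [si si' /andP[sx xs'] ss'r]]]] :=
  path_step_locate 0 hp ss0 hx.
have [y1 [y2 [hy1 hy2 hyy]]] := alternating_stops i d0 hy.
rewrite -ess in si si'.
have d1 : dist1 (x, y) (s, y1) = x - s + `|y - y1|.
  by rewrite /dist1 /= [`|x - s|]ger0_norm // subr_ge0.
have d2 : dist1 (x, y) (s', y2) = s' - x + `|y - y2|.
  by rewrite /dist1 /= [`|x - s'|]distrC [`|s' - x|]ger0_norm // subr_ge0.
rewrite /spacing in ss'r.
have [h|h] := leP (x - s + `|y - y1|) k.
  by exists (s, y1); [exact: mem_stops si hy1 | rewrite d1].
by exists (s', y2); [exact: mem_stops si' hy2 | rewrite d2; lra].
Qed.

Lemma updown_path_length_le {R : realType} (k : R) (m n : nat) (d : R) :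
  (0 < n)%N -> 0 < spacing k d ->
  path_length (updown_path k m n d)
    <= (n%:R / spacing k d + 2) * m%:R + n%:R.
Proof.
move=> n0 r0; have [ss [ess hp _ hl sz]] := traversals_spec n0 r0.
have := updown_length m 0 hp.
rewrite -ess hl subr0 /path_length => ->.
by rewrite lerD2r ler_wpM2r // -natr1; lra.
Qed.

Lemma updown_stop_count_le {R : realType} (k : R) (m n : nat) (d : R) :
  (0 < n)%N -> 0 < d -> 0 < spacing k d ->
  (stop_count (updown_path k m n d))%:R
    <= (n%:R / spacing k d + 2) * (m%:R / d + 2).
Proof.
move=> n0 d0 r0; have [ss [ess _ _ _ sz]] := traversals_spec n0 r0.
rewrite /stop_count size_allpairs_dep.
have hs (l : seq (nat * R)) :
    (sumn [seq size (stop_heights m d e.1) | e <- l])%:R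
      <= (size l)%:R * (m%:R / d + 2) :> R.
  elim: l => [|e l IH]; first by rewrite mul0r.
  rewrite /= natrD -[(size l).+1%:R]nat1r mulrDl mul1r.
  by apply: lerD => //; apply: size_stop_heights.
apply: le_trans (hs _) _; rewrite size_zip size_iota minnn ess /=.
apply: ler_wpM2r; last by rewrite -natr1; lra.
by rewrite addr_ge0 // divr_ge0 // ltW.
Qed.

Theorem theorem2 (R : realType) (m n : nat) (hn : (1 <= n)%N) (hnm : (n <= m)%N)
    (k : R) (hk : 0 < k) (L T : R) (hL : 0 < L) (hT : 1 < T)
    (hLT : (T - 1) * f k (L / (T - 1)) = (m * n)%:R - 2 * k ^+ 2) :
  exists2 d : R, 0 < d <= 2 * k &
    let P := updown_path k m n d in
    [/\ feasible k m n P,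
        path_length P - L <= 3 * m%:R + 2 * k &
        (stop_count P)%:R / T <=
          (1 + 2 * k ^+ 2 / ((m * n)%:R - 2 * k ^+ 2))
            * (1 + 4 * k / n%:R) ^+ 2].
Proof.
have T1 : 0 < T - 1 by lra.
have m0 : (0 < m)%N := leq_trans hn hnm.
have m0' : 0 < m%:R :> R by rewrite ltr0n.
have n0' : 0 < n%:R :> R by rewrite ltr0n.
have nm' : n%:R <= m%:R :> R by rewrite ler_nat.
have [d [d0 dk dL hd]] : exists d : R, [/\ 0 < d, d <= 2 * k,
    d * (T - 1) <= L & (T - 1) * (d * spacing k d) = (m * n)%:R - 2 * k ^+ 2].
  move: hLT; rewrite /f /spacing; case: ifP => hle E.
    exists (L / (T - 1)); rewrite divfK ?gt_eqF //.
    by split=> //; exact: divr_gt0.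
  (* On the constant branch of [f], [d = 2k] gives spacing [k], so [d * r = 2k^2] and the same
     equation holds. *)
  exists (2 * k); split; [lra | by [] | | by rewrite -E; field].
  by rewrite -ler_pdivlMr // ltW // ltNge hle.
have rk : k <= spacing k d by rewrite /spacing; lra.
have r2k : spacing k d <= 2 * k by rewrite /spacing; lra.
move: rk r2k hd; have : 0 < spacing k d by rewrite /spacing; lra.
have := updown_feasible (k := k) m0 hn d0; have := updown_path_length_le m (k := k) (d := d) hn.
have := updown_stop_count_le m (k := k) hn d0.
set r := spacing k d; rewrite natrM => hcount hlen hfeas r0 rk r2k hd.
exists d; first by rewrite d0.
split; first exact: hfeas.
  have hLr : m%:R * n%:R / r - 2 * k <= L.
    apply: le_trans dL; rewrite -(ler_pM2r r0) mulrBl divfK ?gt_eqF //.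
    have -> : d * (T - 1) * r = m%:R * n%:R - 2 * k ^+ 2 by rewrite -hd; ring.
    (* This is [2k^2 <= 2k * r], from [k <= r]. *)
    by rewrite lerD2l lerN2 expr2 mulrA ler_pM2l //; lra.
  have := hlen r0.
  have -> : (n%:R / r + 2) * m%:R + n%:R = m%:R * n%:R / r + 2 * m%:R + n%:R.
    by ring.
  (* The horizontal part [n] is absorbed by [n <= m], giving [3m]. *)
  lra.
have C0 : 0 < m%:R * n%:R - 2 * k ^+ 2 :> R by rewrite -hd !mulr_gt0.
set C := m%:R * n%:R - _ in hd C0 *.
have -> : 1 + 2 * k ^+ 2 / C = m%:R * n%:R / C.
  have -> : 2 * k ^+ 2 = m%:R * n%:R - C by rewrite /C; ring.
  by rewrite mulrBl divff ?gt_eqF //; ring.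
(* [C = (T - 1) * d * r] brings out the main term [N / (d * r)] of the stop count. *)
have -> : m%:R * n%:R / C = m%:R * n%:R / (d * r) / (T - 1).
  by rewrite -hd; field; rewrite !gt_eqF.
rewrite ler_pdivrMr; last lra.
apply: le_trans (hcount r0) _.
(* The factor [T / (T - 1)], which is at least 1, is discarded. *)
apply: le_trans
  (_ : m%:R * n%:R / (d * r) * (1 + 4 * k / n%:R) ^+ 2 <= _); last first.
  rewrite -[leRHS]mulrA -[leRHS]mulrA ler_pM2l ?divr_gt0 ?mulr_gt0 //.
  rewrite mulrCA ler_peMr ?sqr_ge0 // mulrC ler_pdivlMr //; lra.
have -> : (n%:R / r + 2) * (m%:R / d + 2) =
    m%:R * n%:R / (d * r) * ((1 + 2 * r / n%:R) * (1 + 2 * d / m%:R)).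
  by field; rewrite !gt_eqF.
rewrite ler_pM2l ?divr_gt0 ?mulr_gt0 // expr2.
have le1 : 1 + 2 * r / n%:R <= 1 + 4 * k / n%:R.
  by rewrite lerD2l ler_pM2r ?invr_gt0 //; lra.
(* Both [d <= 2k] and [n <= m] enter here, so that the two factors share one bound. *)
have le2 : 1 + 2 * d / m%:R <= 1 + 4 * k / n%:R.
  by rewrite lerD2l ler_pM ?invr_ge0 ?lef_pV2 ?posrE //; lra.
by apply: ler_pM => //; rewrite addr_ge0 // divr_ge0 // mulr_ge0 // ltW.
Qed.
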